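(* For every $\mu>0$, the Lorentzian Lie algebra $(\mathfrak h_3\oplus\mathbb R,S_\mu,J)$ is flat with respect to the canonical connection $\nabla^0$, i.e. $R^0_{uv}w=0$ for all $u,v,w\in\mathfrak h_3\oplus\mathbb R$.
   Context: $\mathfrak h_3\oplus\mathbb R$ is the real Lie algebra with basis $e_1,e_2,e_3,e_4$ and only non-zero bracket (up to skew-symmetry) $[e_1,e_2]=e_3$. For $\mu>0$, $S_\mu$ is the Lorentzian inner product $\langle\cdot,\cdot\rangle$ whose matrix in $(e_1,e_2,e_3,e_4)$ is $\operatorname{diag}(1,-1,\mu,1)$. Fix the basis $v_1=e_1$, $v_2=\frac1{\sqrt\mu}e_3$, $v_3=e_4$, $v_4=e_2$, which is orthonormal: $\langle v_i,v_j\rangle=0$ for $i\ne j$, $\langle v_i,v_i\rangle=1$ for $i=1,2,3$, $\langle v_4,v_4\rangle=-1$. The product structure $J$ is the linear map with $Jv_i=v_i$ for $i=1,2,3$ and $Jv_4=-v_4$. Write $\mathfrak g$ for the Lie algebra. The Levi-Civita connection is the bilinear map $\nabla:\mathfrak g\times\mathfrak g\to\mathfrak g$ with $2\langle\nabla_uv,w\rangle=\langle[u,v],w\rangle+\langle[w,u],v\rangle+\langle[w,v],u\rangle$ for all $u,v,w$. Put $(\nabla_uJ)v=\nabla_u(Jv)-J(\nabla_uv)$. The canonical connection is $\nabla^0_uv=\nabla_uv-\frac12(\nabla_uJ)Jv$, and its curvature is $R^0_{uv}w=\nabla^0_{[u,v]}w-\nabla^0_u\nabla^0_vw+\nabla^0_v\nabla^0_uw$.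 *)

(* Defs.v *)
From HB Require Import structures.
From mathcomp Require Import all_boot all_order all_algebra.
From mathcomp Require Import reals.
From mathcomp Require Import ring.

Set Implicit Arguments.
Unset Strict Implicit.
Unset Printing Implicit Defensive.

Import Order.TTheory GRing.Theory Num.Theory.

Local Open Scope ring_scope.

Section Connections.
Variables (R : realType) (g : lmodType R).
Implicit Types (br nabla : g -> g -> g) (J : g -> g) (ip : g -> g -> R).

Definition is_levi_civita br ip nabla : Prop :=
  forall u v w,
    2 * ip (nabla u v) w = ip (br u v) w + ip (br w u) v + ip (br w v) u.

Definition nablaJ nabla J u v : g := nabla u (J v) - J (nabla u v).

Definition canonical_connection nabla J u v : g :=
  nabla u v - 2^-1 *: nablaJ nabla J u (J v).

Definition curvature br nabla u v w : g :=
  nabla (br u v) w - nabla u (nabla v w) + nabla v (nabla u w).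

Definition flat br nabla : Prop := forall u v w, curvature br nabla u v w = 0.

End Connections.

Section H3R.
Variable R : realType.
Implicit Types (mu : R) (u v w : 'rV[R]_4).

(* Elements of h_3 (+) R are coordinate row vectors in the basis
   (e1, e2, e3, e4); since matrix indices start at 0, the coordinate of u
   along e_k is u 0 (k - 1). *)
Definition e1 : 'rV[R]_4 := delta_mx 0 0.
Definition e2 : 'rV[R]_4 := delta_mx 0 1.
Definition e3 : 'rV[R]_4 := delta_mx 0 2.
Definition e4 : 'rV[R]_4 := delta_mx 0 3.

Definition bracket u v : 'rV[R]_4 := (u 0 0 * v 0 1 - u 0 1 * v 0 0) *: e3.

Definition S_mx mu : 'M[R]_4 := diag_mx (\row_(i < 4) [:: 1; -1; mu; 1]`_i).

Definition S_ip mu u v : R := (u *m S_mx mu *m v^T) 0 0.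

Definition v1 : 'rV[R]_4 := e1.
Definition v2 mu : 'rV[R]_4 := (Num.sqrt mu)^-1 *: e3.
Definition v3 : 'rV[R]_4 := e4.
Definition v4 : 'rV[R]_4 := e2.

Definition is_product_structure mu (J : 'rV[R]_4 -> 'rV[R]_4) : Prop :=
  [/\ J v1 = v1, J (v2 mu) = v2 mu, J v3 = v3 & J v4 = - v4].

Lemma row4P u v :
  u 0 0 = v 0 0 -> u 0 1 = v 0 1 -> u 0 2 = v 0 2 -> u 0 3 = v 0 3 -> u = v.
Proof.
move=> h0 h1 h2 h3; apply/rowP => -[[|[|[|[|//]]]] hi].
- by rewrite (_ : Ordinal hi = 0) //; apply/val_inj.
- by rewrite (_ : Ordinal hi = 1) //; apply/val_inj.
- by rewrite (_ : Ordinal hi = 2) //; apply/val_inj.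
- by rewrite (_ : Ordinal hi = 3) //; apply/val_inj.
Qed.

Lemma S_ipE mu u v :
  S_ip mu u v = u 0 0 * v 0 0 - u 0 1 * v 0 1 + mu * u 0 2 * v 0 2
                + u 0 3 * v 0 3.
Proof.
rewrite /S_ip /S_mx mul_mx_diag mxE !big_ord_recl big_ord0 !mxE /=.
rewrite (_ : lift ord0 ord0 = 1); last exact/val_inj.
rewrite (_ : lift ord0 (lift ord0 ord0) = 2); last exact/val_inj.
rewrite (_ : lift ord0 (lift ord0 (lift ord0 ord0)) = 3); last exact/val_inj.
by rewrite (_ : ord0 = 0); [ring|exact/val_inj].
Qed.

Lemma bracketE u v :
  (bracket u v 0 0 = 0) * (bracket u v 0 1 = 0) *
  (bracket u v 0 2 = u 0 0 * v 0 1 - u 0 1 * v 0 0) * (bracket u v 0 3 = 0).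
Proof. by rewrite !mxE /= !mulr0 mulr1. Qed.

Lemma bracket_is_bilinear :
  bilinear_for ( *:%R) ( *:%R) (bracket : 'rV[R]_4 -> 'rV[R]_4 -> 'rV[R]_4).
Proof.
by split=> [w|w] a u v; apply: row4P; rewrite /applyr !mxE /=; ring.
Qed.

HB.instance Definition _ := bilinear_isBilinear.Build R 'rV[R]_4 'rV[R]_4
  'rV[R]_4 ( *:%R) ( *:%R) bracket bracket_is_bilinear.

Lemma bracketxx u : bracket u u = 0.
Proof. by apply: row4P; rewrite !mxE /=; ring. Qed.

Lemma bracket_jacobi u v w :
  bracket u (bracket v w) + bracket v (bracket w u)
  + bracket w (bracket u v) = 0.
Proof. by apply: row4P; rewrite !mxE /=; ring. Qed.

Lemma bracket_basis :
  [/\ bracket e1 e2 = e3, bracket e1 e3 = 0, bracket e1 e4 = 0 &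
  [/\ bracket e2 e3 = 0, bracket e2 e4 = 0 & bracket e3 e4 = 0]].
Proof. by split; last split; apply: row4P; rewrite !mxE /=; ring. Qed.

Lemma S_ip_orthonormal mu : 0 < mu ->
  [/\ [/\ S_ip mu v1 v1 = 1, S_ip mu (v2 mu) (v2 mu) = 1,
          S_ip mu v3 v3 = 1 & S_ip mu v4 v4 = -1],
      [/\ S_ip mu v1 (v2 mu) = 0, S_ip mu v1 v3 = 0 & S_ip mu v1 v4 = 0] &
      [/\ S_ip mu (v2 mu) v3 = 0, S_ip mu (v2 mu) v4 = 0 & S_ip mu v3 v4 = 0]].
Proof.
move=> mu0; have s0 : Num.sqrt mu != 0 by rewrite sqrtr_eq0 -ltNge.
have smu : mu = Num.sqrt mu ^+ 2 by rewrite sqr_sqrtr // ltW.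
do 2?split; rewrite S_ipE !mxE /=; try ring.
by rewrite [X in X * _ * _]smu; field.
Qed.

Section Existence.
Variable mu : R.

Definition lc u v : 'rV[R]_4 :=
  \row_(i < 4) [:: mu / 2 * (u 0 1 * v 0 2 + v 0 1 * u 0 2);
                   mu / 2 * (u 0 0 * v 0 2 + v 0 0 * u 0 2);
                   2^-1 * (u 0 0 * v 0 1 - u 0 1 * v 0 0); 0]`_i.

Lemma lc_is_bilinear :
  bilinear_for ( *:%R) ( *:%R) (lc : 'rV[R]_4 -> 'rV[R]_4 -> 'rV[R]_4).
Proof.
by split=> [w|w] a u v; apply: row4P; rewrite /applyr !mxE /=; ring.
Qed.

HB.instance Definition _ := bilinear_isBilinear.Build R 'rV[R]_4 'rV[R]_4
  'rV[R]_4 ( *:%R) ( *:%R) lc lc_is_bilinear.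

Definition prodJ u : 'rV[R]_4 :=
  \row_(i < 4) [:: u 0 0; - u 0 1; u 0 2; u 0 3]`_i.

Lemma prodJ_is_linear : linear (prodJ : 'rV[R]_4 -> 'rV[R]_4).
Proof. by move=> a u v; apply: row4P; rewrite !mxE /=; ring. Qed.

HB.instance Definition _ := GRing.isLinear.Build R 'rV[R]_4 'rV[R]_4 *:%R
  prodJ prodJ_is_linear.

Lemma levi_civita_exists :
  exists nabla : {bilinear 'rV[R]_4 -> 'rV[R]_4 -> 'rV[R]_4},
    is_levi_civita bracket (S_ip mu) nabla.
Proof.
by exists lc => u v w; rewrite !S_ipE !bracketE !mxE /=; field.
Qed.

Lemma levi_civita_unique (nabla nabla' : 'rV[R]_4 -> 'rV[R]_4 -> 'rV[R]_4) :
  0 < mu -> is_levi_civita bracket (S_ip mu) nabla ->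
  is_levi_civita bracket (S_ip mu) nabla' -> nabla =2 nabla'.
Proof.
move=> mu0 h h' u v.
have E w : S_ip mu (nabla u v) w = S_ip mu (nabla' u v) w.
  by apply: (@mulfI _ 2); rewrite ?pnatr_eq0// h h'.
have := (E e1, E e2, E e3, E e4); rewrite !S_ipE !mxE /=.
rewrite !(mulr0, mulr1, addr0, subr0, sub0r, add0r).
case=> -[[h0 /oppr_inj h1] /mulfI h2] h3.
by apply: row4P => //; apply: h2; rewrite gt_eqF.
Qed.

Lemma product_structure_exists :
  exists J : {linear 'rV[R]_4 -> 'rV[R]_4}, is_product_structure mu J.
Proof.
by exists prodJ; split; apply: row4P; rewrite !mxE /=; ring.
Qed.

Lemma product_structure_unique (J J' : {linear 'rV[R]_4 -> 'rV[R]_4}) :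
  0 < mu -> is_product_structure mu J -> is_product_structure mu J' -> J =1 J'.
Proof.
move=> mu0 [h1 h2 h3 h4] [k1 k2 k3 k4] u.
have s0 : Num.sqrt mu != 0 by rewrite sqrtr_eq0 -ltNge.
have -> : u = u 0 0 *: v1 + (u 0 2 * Num.sqrt mu) *: v2 mu + u 0 3 *: v3
              + u 0 1 *: v4.
  by apply: row4P; rewrite !mxE /=; field.
move: (v2 mu) h2 k2 => x h2 k2.
by rewrite !linearD !linearZ /= h1 h2 h3 h4 k1 k2 k3 k4.
Qed.

End Existence.

End H3R.

(* Main.v *)
Require Import Defs.
From mathcomp Require Import all_boot all_order all_algebra.
From mathcomp Require Import reals.
From mathcomp Require Import ring.

Import Order.TTheory GRing.Theory Num.Theory.
Local Open Scope ring_scope.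

(** Averaging the Levi-Civita connection over [J] only keeps the terms that
    preserve the eigenspaces of [J], and these all carry the [e2]-coordinate
    of the first argument: [nabla^0_u = u_2 A] for one fixed endomorphism [A].
    Hence the operators [nabla^0_u] commute, and [nabla^0_[u,v] = 0] because
    brackets are multiples of [e3]. *)

Lemma lc_is_levi_civita (R : realType) (mu : R) :
  is_levi_civita (@bracket R) (S_ip mu) (lc mu).
Proof. by move=> u v w; rewrite !S_ipE !bracketE !mxE /=; field. Qed.

Lemma prodJ_is_product_structure (R : realType) (mu : R) :
  is_product_structure mu (@prodJ R).
Proof. by split; apply: row4P; rewrite !mxE /=; ring. Qed.

(** The [A] above, that is [nabla^0_e2]: for [mu > 0] an infinitesimal rotation of the plane of [e1]
    and [e3]. *)
Definition canonical_endo (R : realType) (mu : R) (v : 'rV[R]_4) : 'rV[R]_4 :=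
  (mu / 2 * v 0 2) *: e1 R - (v 0 0 / 2) *: e3 R.

Lemma canonical_connectionE (R : realType) (mu : R) (hmu : 0 < mu)
    (nabla : 'rV[R]_4 -> 'rV[R]_4 -> 'rV[R]_4)
    (J : {linear 'rV[R]_4 -> 'rV[R]_4})
    (hnabla : is_levi_civita (@bracket R) (S_ip mu) nabla)
    (hJ : is_product_structure mu J) (u v : 'rV[R]_4) :
  canonical_connection nabla J u v = u 0 1 *: canonical_endo R mu v.
Proof.
have nablaE := levi_civita_unique hmu hnabla (lc_is_levi_civita R mu).
have JE : J =1 @prodJ R.
  exact: product_structure_unique hmu hJ (prodJ_is_product_structure R mu).
(* Since [prodJ] is an involution, the left side is [(lc u v + J (lc u (J v))) / 2]. *)
rewrite /canonical_connection /nablaJ !nablaE !JE.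
by apply: row4P; rewrite !mxE /=; field.
Qed.

Theorem theorem4p3 (R : realType) (mu : R) (hmu : 0 < mu)
    (nabla : {bilinear 'rV[R]_4 -> 'rV[R]_4 -> 'rV[R]_4})
    (J : {linear 'rV[R]_4 -> 'rV[R]_4})
    (hnabla : is_levi_civita (@bracket R) (S_ip mu) nabla)
    (hJ : is_product_structure mu J) :
  flat (@bracket R) (canonical_connection nabla J).
Proof.
move=> u v w; rewrite /curvature !(canonical_connectionE R mu hmu nabla J) //.
(* The [e2]-coordinate of [bracket u v] is 0; the other two terms are [u_2 v_2 A (A w)] with
   opposite signs. *)
by rewrite bracketE; apply: row4P; rewrite !mxE /=; ring.
Qed.
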